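(* For positive integers $m,n$, the series $$S_{m,n}=\sum_{\substack{i\ge1\\ m\mid i}}\ \sum_{\substack{j\ge1\\ mn\mid ij}}\frac{\mu(j)}{i^2j\,\varphi(ij)}$$ converges and equals $$S_{m,n}=\frac{S}{m^3n^3}\prod_{p\mid n}\frac{-p^4}{p^3-p-1}\prod_{\substack{p\mid m\\ p\nmid n}}\frac{p^3+p^2}{p^3-p-1},$$ where $S=\prod_{p\text{ prime}}\bigl(1-\frac{p}{p^3-1}\bigr)$ and products are over primes $p$.
   Context: $\mu$ is the Möbius function and $\varphi$ Euler's totient function. *)

(* Defs.v *)
From HB Require Import structures.
From mathcomp Require Import all_boot all_order all_algebra.
From mathcomp Require Import all_classical all_reals all_analysis.
Set Implicit Arguments. Unset Strict Implicit. Unset Printing Implicit Defensive.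
Import Order.TTheory GRing.Theory Num.Theory numFieldNormedType.Exports.
Local Open Scope ring_scope.

Definition squarefree (n : nat) : bool :=
  (0 < n)%N && all (fun p => logn p n == 1%N) (primes n).

(* Moebius function: mu(n) = (-1)^k if n is a product of k distinct primes,
   0 if n has a square prime factor (and mu 0 := 0, never used). *)
Definition moebius (n : nat) : int :=
  if squarefree n then (-1) ^+ size (primes n) else 0.

Definition Sterm {R : realType} (m n i j : nat) : R :=
  if [&& (0 < i)%N, (m %| i)%N, (0 < j)%N & (m * n %| i * j)%N]
  then (moebius j)%:~R / ((i ^ 2)%:R * j%:R * (totient (i * j))%:R)
  else 0.

Definition Spartial {R : realType} (N : nat) : R :=
  \prod_(p < N | prime p) (1 - p%:R / (p%:R ^+ 3 - 1)).

Definition Sconst {R : realType} : R := limn (@Spartial R).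

Definition Sclosed {R : realType} (m n : nat) : R :=
  Sconst / ((m%:R) ^+ 3 * (n%:R) ^+ 3)
  * (\prod_(p <- primes n) (- (p%:R ^+ 4) / (p%:R ^+ 3 - p%:R - 1)))
  * (\prod_(p <- primes m | ~~ (p %| n)%N)
        ((p%:R ^+ 3 + p%:R ^+ 2) / (p%:R ^+ 3 - p%:R - 1))).

(* Main.v *)
(* The double series is dominated by a product of two convergent series, since
   [n <= 2 * totient n ^ 2] bounds the term at [(i, j)] by
   [2 / (i * sqrt i * j * sqrt j)].  Its sum is therefore the limit of its sums
   over the finite sets of pairs [(i, j)] whose prime factors are [< N], with
   exponents at most [K] in [i] and at most [1] in [j].  Such a finite sum
   factors as a product over the primes [p < N]; letting [K] tend to infinity,
   the factor at [p] becomes a combination of geometric series of ratio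
   [p ^ -3], equal to [1 - p / (p ^ 3 - 1)] times the correction that [m] and
   [n] contribute at [p]. *)
Require Import Defs.
From HB Require Import structures.
From mathcomp Require Import all_boot all_order all_algebra.
From mathcomp Require Import all_classical all_reals all_analysis.
From mathcomp Require Import ring lra zify.
Import Order.TTheory GRing.Theory Num.Theory numFieldNormedType.Exports.
Local Open Scope classical_set_scope.
Local Open Scope ring_scope.
Set Implicit Arguments. Unset Strict Implicit. Unset Printing Implicit Defensive.

(** * Dominated series and double series *)

Lemma le_series_lim (R : realType) (u : nat -> R) (n : nat) :
  (forall k, 0 <= u k) -> cvgn (series u) -> series u n <= limn (series u).
Proof.
move=> u0 cu; apply: nondecreasing_cvgn_le => // a b ab.
by rewrite -subr_ge0 sub_series_geq// sumr_ge0.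
Qed.

Lemma dominated_series (R : realType) (u v : nat -> R) :
    (forall k, `|u k| <= v k) -> cvgn (series v) ->
  cvgn (series u) /\
  forall n, `|limn (series u) - series u n| <= limn (series v) - series v n.
Proof.
move=> uv cv.
have v0 k : 0 <= v k by apply: le_trans (uv k).
have cu : cvgn (series u).
  by apply: normed_cvg; apply: series_le_cvg uv cv.
split=> // n.
have c1 : `|series u k - series u n| @[k --> \oo] -->
    `|limn (series u) - series u n|.
  by apply: cvg_norm; apply: cvgB => //; exact: cvg_cst.
rewrite -(cvg_lim _ c1)//; apply: limr_le; first exact: cvgP c1.
near=> k.
have nk : (n <= k)%N by near: k; exact: nbhs_infty_ge.
rewrite sub_series_geq//; apply: le_trans (ler_norm_sum _ _ _) _.
have : series v k - series v n <= limn (series v) - series v n.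
  by rewrite lerD2r le_series_lim.
by apply: le_trans; rewrite sub_series_geq// ler_sum.
Unshelve. all: by end_near. Qed.

(** The last clause lets the iterated sum be computed along any finite sets that exhaust the support
    of [f]. Only pairs with [f i j != 0] are required in [s], because the sets used later contain no
    pair whose [j] has a square factor. *)
Lemma dominated_double_series (R : realType) (f : nat -> nat -> R)
    (g h : nat -> R) :
    (forall i, 0 <= g i) -> (forall j, 0 <= h j) ->
    (forall i j, `|f i j| <= g i * h j) ->
    cvgn (series g) -> cvgn (series h) ->
  exists T : nat -> R, exists S : R,
  [/\ forall i, series (f i) @ \oo --> T i,
      series T @ \oo --> S &
      forall e, 0 < e -> exists M : nat, forall s : seq (nat * nat), uniq s ->
        (forall i j, (i < M)%N -> (j < M)%N -> f i j != 0 -> (i, j) \in s) ->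
        `|S - \sum_(x <- s) f x.1 x.2| <= e].
Proof.
move=> g0 h0 fgh cg ch.
set G := limn (series g); set H := limn (series h).
have cgh i : cvgn (series (fun j => g i * h j)).
  by have := @is_cvg_seriesZ _ h (g i) ch.
have lgh i : limn (series (fun j => g i * h j)) = g i * H.
  by have := @lim_seriesZ _ h (g i) ch.
have sgh i n : series (fun j => g i * h j) n = g i * series h n.
  by rewrite /series/= mulr_sumr.
pose T i := limn (series (f i)).
have cT i : series (f i) @ \oo --> T i.
  by case: (dominated_series (fgh i) (cgh i)).
have tT i n : `|T i - series (f i) n| <= g i * (H - series h n).
  by case: (dominated_series (fgh i) (cgh i)) => _ /(_ n); rewrite lgh sgh mulrBr.
have H0 : 0 <= H by apply: le_trans (le_series_lim 0 h0 ch); rewrite /series/= big_geq.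
have G0 : 0 <= G by apply: le_trans (le_series_lim 0 g0 cg); rewrite /series/= big_geq.
have T0 i : `|T i| <= H * g i.
  by have := tT i 0%N; rewrite /series/= !big_geq// !subr0 mulrC.
have cgH : cvgn (series (fun i => H * g i)) by have := @is_cvg_seriesZ _ g H cg.
have [cST tST] := dominated_series T0 cgH.
exists T, (limn (series T)); split => // e e0.
(* The three summands bound, in order, the terms outside the square of side [n], the rows of index
   at least [n], and the tails in [j] of the rows. *)
have E0 : G * H - series g n * series h n + H * (G - series g n)
            + G * (H - series h n) @[n --> \oo] --> (0 : R).
  rewrite -[X in _ --> X](_ : G * H - G * H + H * (G - G) + G * (H - H) = 0);
    last by ring.
  apply: cvgD; first apply: cvgD; first apply: cvgB.
  - exact: cvg_cst.
  - exact: cvgM.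
  - by apply: cvgM; [exact: cvg_cst | apply: cvgB => //; exact: cvg_cst].
  - by apply: cvgM; [exact: cvg_cst | apply: cvgB => //; exact: cvg_cst].
have [M _ HM] : \forall n \near \oo,
    G * H - series g n * series h n + H * (G - series g n)
            + G * (H - series h n) <= e.
  by apply: (@cvgr_le _ _ _ _ _ _ E0).
exists M => s us Ms.
(* The square [B L] contains both [s] and [B M]; the sum over it is the intermediate value between
   [S] and the sum over [s]. *)
have [L ML sL] : exists2 L, (M <= L)%N &
    forall x, x \in s -> (x.1 < L)%N && (x.2 < L)%N.
  exists (maxn M (\max_(x <- s) (maxn x.1 x.2).+1)); first exact: leq_maxl.
  move=> x xs; have : ((maxn x.1 x.2).+1 <= \max_(x <- s) (maxn x.1 x.2).+1)%N.
    exact: (@leq_bigmax_seq _ s xpredT (fun x => (maxn x.1 x.2).+1)).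
  lia.
pose B (n : nat) := [seq (i, j) | i <- index_iota 0 n, j <- index_iota 0 n].
have memB n x : (x \in B n) = (x.1 < n)%N && (x.2 < n)%N.
  case: x => i j; apply/allpairsP/andP => /= [[[a b]/= []]|[i_n jn]].
    by rewrite !mem_index_iota/= => an bn [-> ->].
  by exists (i, j); rewrite !mem_index_iota/= i_n jn.
have uB n : uniq (B n).
  by apply: allpairs_uniq; rewrite ?iota_uniq// => -[? ?] [? ?] _ _ [-> ->].
have sumB (F : nat -> nat -> R) n : \sum_(x <- B n) F x.1 x.2 =
    \sum_(0 <= i < n) \sum_(0 <= j < n) F i j.
  by rewrite big_allpairs.
have sumgh n : \sum_(x <- B n) g x.1 * h x.2 = series g n * series h n.
  rewrite (sumB (fun i j => g i * h j)) /series/= mulr_suml.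
  by apply: eq_bigr => i _; rewrite mulr_sumr.
have d1 : `|limn (series T) - series T L| <= H * (G - series g M).
  have := tST L; have -> : limn (series (fun i => H * g i)) = H * G.
    by have := @lim_seriesZ _ g H cg.
  have -> : series (fun i => H * g i) L = H * series g L.
    by rewrite /series/= mulr_sumr.
  rewrite -mulrBr => /le_trans; apply; rewrite ler_wpM2l// lerD2l lerN2.
  by rewrite -subr_ge0 sub_series_geq// sumr_ge0.
have hML : series h M <= series h L.
  by rewrite -subr_ge0 sub_series_geq// sumr_ge0.
have d2 : `|series T L - \sum_(x <- B L) f x.1 x.2| <= G * (H - series h M).
  rewrite sumB /series/= -sumrB; apply: le_trans (ler_norm_sum _ _ _) _.
  apply: (@le_trans _ _ (series g L * (H - series h L))).
    by rewrite mulr_suml; apply: ler_sum => i _; exact: tT.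
  apply: ler_pM => //; [|by rewrite subr_ge0 le_series_lim|exact: le_series_lim|].
    by rewrite /series/= sumr_ge0.
  by rewrite lerD2l lerN2.
have d3 : `|\sum_(x <- B L) f x.1 x.2 - \sum_(x <- s) f x.1 x.2| <=
    G * H - series g M * series h M.
  have -> : \sum_(x <- s) f x.1 x.2 = \sum_(x <- B L | x \in s) f x.1 x.2.
    rewrite -[RHS]big_filter; apply: perm_big; apply: uniq_perm => //.
      by rewrite filter_uniq.
    move=> x; rewrite mem_filter memB andbC.
    by case xs : (x \in s); rewrite ?andbF// sL.
  rewrite (bigID (mem s))/= addrAC subrr add0r.
  (* Among the pairs of [B L] missing from [s], those in [B M] contribute 0 by [Ms]; the others are
     bounded by the mass of [g * h] outside [B M]. *)
  rewrite (bigID (mem (B M)))/= big1 ?add0r; last first.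
    move=> [i j] /andP[ns]; rewrite memB => /andP[iM jM].
    by apply/eqP/negPn/negP => fij; rewrite Ms in ns.
  apply: le_trans (ler_norm_sum _ _ _) _.
  apply: (@le_trans _ _ (\sum_(x <- B L | x \notin B M) g x.1 * h x.2)).
    rewrite big_mkcond [leRHS]big_mkcond/=; apply: ler_sum => x _.
    by case: (x \in B M); rewrite ?andbF//= ?andbT; case: ifP => // _; rewrite mulr_ge0.
  have : \sum_(x <- B L) g x.1 * h x.2 <= G * H.
    rewrite sumgh; apply: ler_pM; rewrite ?le_series_lim//;
    by rewrite /series/= sumr_ge0.
  rewrite (bigID (mem (B M)))/= -[X in X + _]big_filter.
  rewrite (perm_big (B M)) ?sumgh; first by rewrite -lerBrDl.
  apply: uniq_perm; rewrite ?filter_uniq// => x; rewrite mem_filter !memB.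
  apply: andb_idr => /andP[a b]; lia.
have := HM M (leqnn M); apply: le_trans.
rewrite -[X in `|X|](_ : (limn (series T) - series T L) +
  (series T L - \sum_(x <- B L) f x.1 x.2) +
  (\sum_(x <- B L) f x.1 x.2 - \sum_(x <- s) f x.1 x.2) = _); last by ring.
apply: le_trans (ler_normD _ _) _; apply: le_trans (lerD (ler_normD _ _) (lexx _)) _.
lra.
Qed.

(** * Integers whose prime factors are below a bound *)

Lemma logn_prod (I : Type) (r : seq I) (P : pred I) (F : I -> nat) (q : nat) :
    (forall i, P i -> (0 < F i)%N) ->
  logn q (\prod_(i <- r | P i) F i) = (\sum_(i <- r | P i) logn q (F i))%N.
Proof.
move=> F0; have [] // : (0 < \prod_(i <- r | P i) F i)%N /\
    logn q (\prod_(i <- r | P i) F i) = (\sum_(i <- r | P i) logn q (F i))%N.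
apply: (big_rec2 (fun u v => (0 < u)%N /\ logn q u = v)); first by rewrite logn1.
by move=> i u v /F0 Fi [u0 <-]; rewrite muln_gt0 Fi u0 lognM.
Qed.

Lemma dvdn_logn (m n : nat) : (0 < m)%N -> (0 < n)%N ->
  reflect (forall p, prime p -> (logn p m <= logn p n)%N) (m %| n)%N.
Proof.
move=> m0 n0; apply: (iffP idP) => [mn p _|h]; first exact: dvdn_leq_log.
apply/(dvdn_partP _ m0) => p; rewrite inE /= => pm.
have pp : prime p by move: pm; rewrite mem_primes => /and3P[].
by rewrite p_part pfactor_dvdn// h.
Qed.

(** Brings products over the prime divisors of different integers to the common index set of primes
    [p < N], where they can be multiplied factor by factor. *)
Lemma big_primes_ord (R : Type) (idx : R) (op : Monoid.com_law idx)
    (N n : nat) (P : pred nat) (F : nat -> R) :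
    (0 < n)%N -> (forall p, prime p -> (p %| n)%N -> (p < N)%N) ->
  \big[op/idx]_(p <- primes n | P p) F p =
  \big[op/idx]_(p < N | prime p && ((p %| n)%N && P p)) F p.
Proof.
move=> n0 nN; rewrite -(big_mkord (fun p => prime p && ((p %| n)%N && P p))).
rewrite -big_filter -[RHS]big_filter; apply: perm_big; apply: uniq_perm.
- by rewrite filter_uniq// primes_uniq.
- by rewrite filter_uniq// iota_uniq.
move=> p; rewrite !mem_filter mem_primes mem_index_iota n0/=.
case pp: (prime p); rewrite ?andbF//=; case pn: (p %| n)%N; rewrite ?andbF//=.
by rewrite nN.
Qed.

(** Encoding integers by exponent functions on the finite type ['I_N] makes the expansion of a
    product of sums over exponents a sum over such integers. *)
Definition ppow (N : nat) (e : 'I_N -> nat) : nat :=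
  (\prod_(p < N | prime p) p ^ e p)%N.

Lemma ppow_gt0 (N : nat) (e : 'I_N -> nat) : (0 < ppow e)%N.
Proof. by apply: prodn_cond_gt0 => p /prime_gt0 p0; rewrite expn_gt0 p0. Qed.

Lemma logn_ppow (N : nat) (e : 'I_N -> nat) (p : 'I_N) :
  prime p -> logn p (ppow e) = e p.
Proof.
move=> pp; rewrite logn_prod => [|q /prime_gt0 q0]; last by rewrite expn_gt0 q0.
rewrite (bigD1 p)//= lognX logn_prime// eqxx muln1 big1 ?addn0// => q /andP[qp nq].
by rewrite lognX logn_prime// eq_sym (inj_eq val_inj) (negbTE nq) muln0.
Qed.

Lemma logn_ppow_ge (N : nat) (e : 'I_N -> nat) (q : nat) :
  (N <= q)%N -> logn q (ppow e) = 0%N.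
Proof.
move=> Nq; rewrite logn_prod => [|p /prime_gt0 p0]; last by rewrite expn_gt0 p0.
rewrite big1// => p pp; rewrite lognX logn_prime//; have := ltn_ord p.
by case: eqP => [|_]; [lia | rewrite muln0].
Qed.

Lemma ppow_logn (N n : nat) : (0 < n)%N ->
    (forall p, prime p -> (p %| n)%N -> (p < N)%N) ->
  ppow (fun p : 'I_N => logn p n) = n.
Proof.
move=> n0 nN; apply: eqn_from_log => //; first exact: ppow_gt0.
move=> q; case: (boolP (prime q)) => [pq|npq]; last first.
  by rewrite [LHS]lognE [RHS]lognE (negbTE npq).
have [qN|Nq] := ltnP q N; first exact: (@logn_ppow N _ (Ordinal qN)).
rewrite logn_ppow_ge// lognE pq n0; case: ifP => //= /(nN _ pq); lia.
Qed.

Lemma ppow_dvdn (N : nat) (e : 'I_N -> nat) (p : 'I_N) :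
  prime p -> (p %| ppow e)%N = (0 < e p)%N.
Proof.
by move=> pp; rewrite -(logn_ppow e pp) -pfactor_dvdn// ?expn1// ppow_gt0.
Qed.

Lemma ppow_dvdn_lt (N : nat) (e : 'I_N -> nat) (p : nat) :
  prime p -> (p %| ppow e)%N -> (p < N)%N.
Proof.
move=> pp; rewrite -[p in (p %| _)%N]expn1 pfactor_dvdn ?ppow_gt0//.
by case: (ltnP p N) => // Np; rewrite logn_ppow_ge.
Qed.

Lemma ppowD (N : nat) (e f : 'I_N -> nat) :
  (ppow e * ppow f)%N = ppow (fun p => e p + f p)%N.
Proof. by rewrite -big_split; apply: eq_bigr => p _; rewrite expnD. Qed.

Lemma totient_ppow (N : nat) (e : 'I_N -> nat) :
  totient (ppow e) = (\prod_(p < N | prime p) totient (p ^ e p))%N.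
Proof.
rewrite totientE ?ppow_gt0// (@big_primes_ord _ _ _ N) ?ppow_gt0//; last first.
  by move=> p; exact: ppow_dvdn_lt.
rewrite big_mkcondr; apply: eq_bigr => p pp; rewrite andbT ppow_dvdn// logn_ppow//.
by have [e0|] := posnP (e p); [rewrite e0 | move=> e0; rewrite totient_pfactor].
Qed.

Lemma squarefree_ppow (N : nat) (e : 'I_N -> nat) :
  (forall p, (e p <= 1)%N) -> squarefree (ppow e).
Proof.
move=> e1; rewrite /squarefree ppow_gt0; apply/allP => p.
rewrite mem_primes => /and3P[pp _ pe]; have pN := ppow_dvdn_lt pp pe.
have := logn_ppow e (p := Ordinal pN) pp; have := ppow_dvdn e (p := Ordinal pN) pp.
by rewrite /= pe => /esym + ->; have := e1 (Ordinal pN); lia.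
Qed.

Lemma moebius_ppow (R : comPzRingType) (N : nat) (e : 'I_N -> nat) :
    (forall p, (e p <= 1)%N) ->
  (moebius (ppow e))%:~R = \prod_(p < N | prime p) (-1) ^+ e p :> R.
Proof.
move=> e1; rewrite /moebius squarefree_ppow//.
have -> : ((-1) ^+ size (primes (ppow e)) : int)%:~R =
    \prod_(p <- primes (ppow e)) -1 :> R.
  by rewrite big_const_seq count_predT GRing.iter_mulr_1 rmorphXn rmorphN1.
rewrite (@big_primes_ord _ _ _ N) ?ppow_gt0//; last first.
  by move=> p; exact: ppow_dvdn_lt.
rewrite big_mkcondr; apply: eq_bigr => p pp; rewrite andbT ppow_dvdn//.
by have := e1 p; case: (e p) => [|[]].
Qed.

(* The factor 2 is only needed for the prime 2: [totient 2 = 1]. *)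
Lemma leq_totient_sqr (n : nat) : (0 < n)%N -> (n <= 2 * totient n ^ 2)%N.
Proof.
move=> n0.
(* The bound [n.+3] keeps 2 among the indices even for small [n], so that the product of the [c p]
   is exactly 2. *)
have nN p : prime p -> (p %| n)%N -> (p < n.+3)%N.
  by move=> _ /(dvdn_leq n0); lia.
rewrite -(ppow_logn n0 nN) totient_ppow.
pose c (p : nat) := (if p == 2 then 2 else 1)%N.
have c2 : (\prod_(p < n.+3 | prime p) c p)%N = 2%N.
  have h2 : (2 < n.+3)%N by [].
  rewrite (bigD1 (Ordinal h2))//= big1 ?muln1// => p /andP[_].
  by rewrite -val_eqE/= /c => /negbTE ->.
rewrite -[X in (_ <= X * _)%N]c2 -mulnn -!big_split /=.
apply: leq_prod => p pp; rewrite mulnn.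
have [->|e0] := posnP (logn p n); first by rewrite expn0 /= /c; case: ifP.
rewrite totient_pfactor// expnMn; have p1 := prime_gt1 pp.
case: (logn p n) e0 => // e _; rewrite expnS /=.
(* For [p >= 3] this is [p <= 2 * (p - 1) <= (p - 1) ^ 2]. The remaining power [p ^ e] occurs once
   on the left and squared on the right. *)
have pc : (p <= c p * p.-1 ^ 2)%N.
  rewrite /c; case: eqP => [->//|p2]; rewrite mul1n -mulnn.
  have p3 : (2 <= p.-1)%N by lia.
  by apply: leq_trans (leq_mul p3 (leqnn _)); lia.
rewrite mulnA -(mulnn (p ^ e)) mulnA leq_mul//.
by apply: leq_trans pc (leq_pmulr _ _); rewrite expn_gt0 prime_gt0.
Qed.

(** * Finite Euler products *)

(** Contribution of [p] to the term at [(i, j)] when [p] has exponent [a] in [i] and [b <= 1] in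
    [j]; then [(-1) ^+ b] is the Möbius value at [p ^ b]. *)
Definition local_term (R : realType) (m n p a b : nat) : R :=
  if (logn p m <= a)%N && (logn p m + logn p n <= a + b)%N
  then (-1) ^+ b / (((p ^ a) ^ 2)%:R * (p ^ b)%:R * (totient (p ^ (a + b)))%:R)
  else 0.

Lemma dvdn_ppow (N m : nat) (e : 'I_N -> nat) : (0 < m)%N ->
    (forall p, prime p -> (p %| m)%N -> (p < N)%N) ->
  (m %| ppow e)%N = [forall p : 'I_N, prime p ==> (logn p m <= e p)%N].
Proof.
move=> m0 mN; apply/(dvdn_logn m0 (ppow_gt0 e))/forallP => h.
  by move=> p; apply/implyP => pp; rewrite -(logn_ppow e pp) h.
move=> p pp; have [pN|Np] := ltnP p N.
  by have := h (Ordinal pN); rewrite /= pp -(logn_ppow e (p := Ordinal pN)).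
rewrite lognE pp m0; case: ifP => //= /(mN _ pp); lia.
Qed.

(** Both divisibility conditions can be tested prime by prime, and the Möbius function, the totient
    and the powers split over the factorization. If a condition fails at one prime, that local
    factor is 0 and so are both sides. *)
Lemma Sterm_ppow (R : realType) (m n N : nat) (a b : 'I_N -> nat) :
    (0 < m)%N -> (0 < n)%N ->
    (forall p, prime p -> (p %| m * n)%N -> (p < N)%N) ->
    (forall p, (b p <= 1)%N) ->
  Sterm m n (ppow a) (ppow b) =
  \prod_(p < N | prime p) local_term R m n p (a p) (b p).
Proof.
move=> m0 n0 mnN b1; rewrite /Sterm !ppow_gt0 /= ppowD !dvdn_ppow ?muln_gt0 ?m0//;
  last by move=> p pp pm; rewrite mnN// dvdn_mulr.
rewrite /local_term; case: ifPn => [/andP[/forallP h1 /forallP h2]|h].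
  under eq_bigr => p pp.
    have := implyP (h1 p) pp; have := implyP (h2 p) pp.
    rewrite lognM// => -> ->; over.
  rewrite prodf_div !big_split /= totient_ppow moebius_ppow//; congr (_ / _).
  by rewrite -!natr_prod; congr (_ * _ * _); rewrite big_split.
have [p pp hp] : exists2 p : 'I_N, prime p &
    ~~ ((logn p m <= a p)%N && (logn p m + logn p n <= a p + b p)%N).
  move: h; rewrite negb_and => /orP[] /forallPn[p]; rewrite negb_imply.
    by move=> /andP[pp hp]; exists p => //; rewrite negb_and hp.
  by rewrite lognM// => /andP[pp hp]; exists p => //; rewrite negb_and hp orbT.
by rewrite (bigD1 p)//= (negbTE hp) mul0r.
Qed.

Lemma ltn_logn (p n M : nat) : (0 < n)%N -> (n < M)%N -> (logn p n < M)%N.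
Proof.
move=> n0 nM; case: (boolP (prime p)) => [pp|npp]; last first.
  by rewrite lognE (negbTE npp); apply: leq_trans nM.
have := dvdn_leq n0 (pfactor_dvdnn p n).
have := ltn_expl (logn p n) (prime_gt1 pp); lia.
Qed.

(* The list [s] enumerates the pairs [(\prod_p p ^ a_p, \prod_p p ^ b_p)] over
   the primes [p < N], with [a_p <= K] and [b_p <= 1]. *)
Lemma euler_product_finite (R : realType) (m n N K : nat) :
    (0 < m)%N -> (0 < n)%N ->
    (forall p, prime p -> (p %| m * n)%N -> (p < N)%N) ->
  exists s : seq (nat * nat), [/\ uniq s,
    forall i j, (0 < i)%N -> squarefree j ->
      (forall p, prime p -> (p %| i * j)%N -> (p < N)%N) ->
      (forall p, (logn p i <= K)%N) -> (i, j) \in s &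
    \sum_(x <- s) Sterm m n x.1 x.2 = \prod_(p < N | prime p)
      \sum_(a < K.+1) \sum_(b < 2) local_term R m n p a b].
Proof.
move=> m0 n0 mnN.
pose J := ('I_K.+1 * 'I_2)%type; pose j0 : J := (ord0, ord0).
pose P : pred 'I_N := fun p => prime p.
(* Families in [A] take the default value [j0] at non-primes, which [ppow] cannot see; this makes
   [h] injective on [A]. *)
pose A := pfamily j0 P (fun=> predT).
pose h (f : {ffun 'I_N -> J}) : nat * nat :=
  (ppow (fun p => (f p).1 : nat), ppow (fun p => (f p).2 : nat)).
exists [seq h f | f <- enum A]; split.
- rewrite map_inj_in_uniq ?enum_uniq// => f g; rewrite !mem_enum.
  move=> /pfamilyP[/fintype.subsetP fP _] /pfamilyP[/fintype.subsetP gP _] [h1 h2].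
  apply/ffunP => p; case: (boolP (prime p)) => [pp|npp].
    rewrite [f p]surjective_pairing [g p]surjective_pairing.
    have := logn_ppow (fun p => (f p).1 : nat) pp.
    have := logn_ppow (fun p => (f p).2 : nat) pp.
    by rewrite h1 h2 !logn_ppow// => e2 e1; congr (_, _); exact: val_inj.
  have -> : f p = j0 by apply/eqP/negPn/negP => /fP; exact/negP.
  by symmetry; apply/eqP/negPn/negP => /gP; exact/negP.
- move=> i j i0 sj ijN iK.
  have j0' : (0 < j)%N by case/andP: sj.
  have jK p : (logn p j < 2)%N.
    case/andP: sj => _ /allP sj; have := sj p; rewrite -logn_gt0.
    by case: (logn p j) => [|k]//= /(_ isT)/eqP ->.
  pose f : {ffun 'I_N -> J} := [ffun p : 'I_N =>
    if prime p then (inord (logn p i), inord (logn p j)) else j0].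
  apply/mapP; exists f.
    rewrite mem_enum; apply/pfamilyP; split=> //.
    by apply/fintype.subsetP => p; rewrite inE ffunE unfold_in;
      case: ifP => //; rewrite eqxx.
  rewrite /h; congr (_, _).
    rewrite -[LHS](@ppow_logn N)//; last by move=> p pp pi; rewrite ijN// dvdn_mulr.
    by apply: eq_bigr => p pp; rewrite ffunE pp inordK// ltnS iK.
  rewrite -[LHS](@ppow_logn N)//; last by move=> p pp pi; rewrite ijN// dvdn_mull.
  by apply: eq_bigr => p pp; rewrite ffunE pp inordK.
rewrite big_map big_enum_cond/=.
under [RHS]eq_bigr do rewrite pair_big/=.
(* Distributivity turns the product over [p] of sums over exponent pairs into a sum over the
   families in [A]. *)
rewrite (big_distr_big_dep j0)/=.
rewrite [RHS](eq_bigl (fun f => f \in A)); last first.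
  by move=> f; rewrite !inE.
rewrite big_andbC/=; apply: eq_big => f; first by rewrite ?andbT.
by move=> fA; rewrite Sterm_ppow// => p; rewrite -ltnS.
Qed.

(** * Evaluation of the local factors *)

Lemma cvg_geometric_from (R : realType) (c : nat) (x : R) : `|x| < 1 ->
  series (fun a => if (c <= a)%N then x ^+ a else 0) @ \oo --> x ^+ c / (1 - x).
Proof.
move=> x1; have := @cvg_geometric_series R (x ^+ c) x x1.
set v := series _ => hv; rewrite -(cvg_shiftn c).
apply: cvg_trans hv; apply: near_eq_cvg; near=> k.
rewrite /v -(geometric_partial_tail k c x) [RHS]/series/=.
rewrite [RHS](@big_cat_nat _ _ _ c)/= ?leq_addl// [(k + c)%N]addnC.
rewrite [X in _ = X + _]big_nat [X in _ = X + _]big1 ?add0r; last first.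
  by move=> i /andP[_ ic]; rewrite leqNgt ic.
rewrite big_nat [RHS]big_nat.
by apply: eq_bigr => i /andP[ci _]; rewrite ci.
Unshelve. all: by end_near. Qed.
(** Factor of the closed form at [p]: the power of [p ^ -3] comes from [1 / (m ^ 3 * n ^ 3)], the
    next factor from [S], and the conditionals from the two products over prime divisors. *)
Definition local_factor (R : realType) (m n p : nat) : R :=
  (p%:R ^+ 3)^-1 ^+ (logn p m + logn p n) *
  ((1 - p%:R / (p%:R ^+ 3 - 1)) *
   ((if (p %| n)%N then - (p%:R ^+ 4) / (p%:R ^+ 3 - p%:R - 1) else 1) *
    (if (p %| m)%N && ~~ (p %| n)%N
     then (p%:R ^+ 3 + p%:R ^+ 2) / (p%:R ^+ 3 - p%:R - 1) else 1))).

(** For [a > 0] the totient of [p ^ a] is [(p - 1) * p ^ (a - 1)], so the terms with [b = 0] and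
    those with [b = 1] each form a geometric series of ratio [p ^ -3], up to a correction at
    [a = b = 0]. *)
Lemma cvg_local_sum (R : realType) (m n p : nat) :
    prime p -> (0 < m)%N -> (0 < n)%N ->
  series (fun a => \sum_(b < 2) local_term R m n p a b) @ \oo -->
    local_factor R m n p.
Proof.
move=> pp m0 n0; rewrite /local_factor.
have <- : (0 < logn p m)%N = (p %| m)%N by rewrite logn_gt0 mem_primes pp m0.
have <- : (0 < logn p n)%N = (p %| n)%N by rewrite logn_gt0 mem_primes pp n0.
rewrite /local_term; move: (logn p m) (logn p n) => M B.
set q : R := p%:R; set x := (q ^+ 3)^-1.
have q2 : 2 <= q by rewrite ler_nat prime_gt1.
have q0 : q != 0 by apply/eqP; lra.
have q1 : q - 1 != 0 by apply/eqP; lra.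
have q34 : 4 * q <= q ^+ 3.
  by rewrite exprSr ler_wpM2r ?expr2//; nra.
have q31 : q ^+ 3 - 1 != 0 by apply/eqP; lra.
have q3 : q ^+ 3 - q - 1 != 0 by apply/eqP; lra.
have x1 : `|x| < 1.
  have q30 : 0 < q ^+ 3 by lra.
  by rewrite gtr0_norm ?invr_gt0// invf_lt1//; lra.
have xX a : x ^+ a = (q ^+ a * q ^+ a * q ^+ a)^-1.
  by rewrite exprVn exprAC !exprS expr0 mulr1 mulrA.
pose G c a : R := if (c <= a)%N then x ^+ a else 0.
(* At [a = b = 0] the totient is 1, whereas the geometric formula would give the term [q / (q - 1)];
   [d] is the excess, present only if [p] divides neither [m] nor [n]. *)
pose d a : R := if (a == 0)%N && (M + B == 0)%N then (q - 1)^-1 else 0.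
have tot a : (totient (p ^ a.+1))%:R = (q - 1) * q ^+ a.
  by rewrite totient_pfactor//= natrM natrX -subn1 natrB ?prime_gt0.
(* First exponent [a] allowed when [b = 1]: the conditions are [M <= a] and [M + B <= a + 1]. *)
pose c' := maxn M (M + B).-1.
have -> : (fun a : nat => \sum_(b < 2) if (M <= a)%N && (M + B <= a + b)%N
    then (-1) ^+ b / (((p ^ a) ^ 2)%:R * (p ^ b)%:R * (totient (p ^ (a + b)))%:R)
    else 0) =
  (fun a => q / (q - 1) * G (M + B)%N a - d a - (q * (q - 1))^-1 * G c' a).
  apply/funext => a; rewrite big_ord_recl big_ord1 /= /bump/= addn0 addn1.
  congr (_ + _).
    have -> : (M <= a)%N && (M + B <= a)%N = (M + B <= a)%N by lia.
    rewrite /G /d; case: a => [|a]/=.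
      rewrite leqn0; case: eqP => _; last by rewrite mulr0 subrr.
      by rewrite !expr0 !expn0 !mulr1 invr1; field.
    case: ifP => _; last by rewrite mulr0 subrr.
    rewrite subr0 expr0 expn0 tot !natrX -/q xX !exprS expr0.
    have : q ^+ a != 0 by rewrite expf_neq0.
    move: (q ^+ a) => y y0; field; do ?[apply/andP; split] => //.
  have -> : (M <= a)%N && (M + B <= a.+1)%N = (c' <= a)%N by rewrite /c'; lia.
  rewrite /G; case: ifP => _; last by rewrite mulr0 oppr0.
  rewrite tot !natrX -/q xX !exprS !expr0 !mulr1.
  have : q ^+ a != 0 by rewrite expf_neq0.
  move: (q ^+ a) => y y0; field; do ?[apply/andP; split] => //.
have cd : series d @ \oo --> d 0%N.
  apply: cvg_near_cst; near=> k; have k0 : (0 < k)%N by near: k; exact: nbhs_infty_gt.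
  by rewrite /series/= -(prednK k0) big_nat_recl// big1 ?addr0.
have -> : series (fun a => q / (q - 1) * G (M + B)%N a - d a
      - (q * (q - 1))^-1 * G c' a) =
    (fun k => q / (q - 1) * series (G (M + B)%N) k - series d k
      - (q * (q - 1))^-1 * series (G c') k).
  by apply/funext => k; rewrite /series/= !sumrB -!mulr_sumr.
suff -> : x ^+ (M + B) * ((1 - q / (q ^+ 3 - 1)) *
      ((if (0 < B)%N then - q ^+ 4 / (q ^+ 3 - q - 1) else 1) *
       (if (0 < M)%N && ~~ (0 < B)%N
        then (q ^+ 3 + q ^+ 2) / (q ^+ 3 - q - 1) else 1))) =
    q / (q - 1) * (x ^+ (M + B) / (1 - x)) - d 0%N
      - (q * (q - 1))^-1 * (x ^+ c' / (1 - x)).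
  apply: cvgB; [apply: cvgB => // | ]; apply: cvgM;
  by [exact: cvg_cst | exact: cvg_geometric_from].
have x1E : (1 - x)^-1 = q ^+ 3 / (q ^+ 3 - 1).
  by rewrite /x; field; do ?[apply/andP; split] => //; rewrite ?expf_neq0.
(* Three cases: if [p] divides [n], the [b = 1] series starts one step before the [b = 0] series; if
   [p] divides only [m], both start at [M]; if [p] divides neither, the correction [d] enters. *)
rewrite x1E /d /c'; clear d cd c'; case: B => [|B]; last first.
  have -> : maxn M (M + B.+1).-1 = (M + B)%N by lia.
  rewrite addnS/= andbF exprS /x; move: ((q ^+ 3)^-1 ^+ (M + B)) => y.
  by field; do ?[apply/andP; split] => //.
rewrite addn0 (maxn_idPl (leq_pred M)); case: M => [|M]/=.
  by rewrite expr0; field; do ?[apply/andP; split] => //.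
move: (x ^+ M.+1) => y.
by field; do ?[apply/andP; split] => //.
Unshelve. all: by end_near. Qed.

(** * Domination of the terms, and the products over primes *)

(** Comparison with the integral of [x ^ (-3/2)]: one plus the integral from 1 to [n + 1] is
    [3 - 2 / sqrt (n + 1)], and this bound is proved by induction. *)
Lemma cvg_series_inv_mul_sqrt (R : realType) :
  cvgn (series (fun n : nat => (n%:R * Num.sqrt n%:R)^-1 : R)).
Proof.
set u := fun n : nat => _.
have u0 n : 0 <= u n by rewrite invr_ge0 mulr_ge0// sqrtr_ge0.
apply: nondecreasing_is_cvgn.
  by move=> a b ab; rewrite -subr_ge0 sub_series_geq// sumr_ge0.
(* The term of index 0 is 0, since the inverse of 0 is 0; the case [n = 0] is then the equality
   [1 = 3 - 2]. *)
have ub n : series u n.+2 <= 3 - 2 / Num.sqrt n.+1%:R.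
  elim: n => [|n IHn].
    rewrite !seriesSr /series/= big_geq// /u mul0r invr0 sqrtr1; lra.
  rewrite seriesSr; apply: le_trans (lerD IHn (lexx _)) _.
  rewrite /u; set s := Num.sqrt n.+1%:R; set t := Num.sqrt n.+2%:R.
  have s0 : 0 < s by rewrite sqrtr_gt0 ltr0n.
  have t0 : 0 < t by rewrite sqrtr_gt0 ltr0n.
  have s2 : n.+1%:R = s ^+ 2 by rewrite sqr_sqrtr ?ler0n.
  have t2 : n.+2%:R = t ^+ 2 by rewrite sqr_sqrtr ?ler0n.
  have st : t ^+ 2 = s ^+ 2 + 1 by rewrite -s2 -t2 -natr1.
  have lst : s < t by rewrite ltr_sqrt ?ltr0n// ltr_nat.
  rewrite t2 -subr_ge0.
  rewrite (_ : _ - _ = (2 * t ^+ 2 * (t - s) - s) / (s * t ^+ 3)); last first.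
    by field; rewrite ?lt0r_neq0.
  rewrite divr_ge0 ?mulr_ge0 ?exprn_ge0 ?(ltW s0) ?(ltW t0)//.
  have : 0 < t + s by lra.
  (* Multiplying the numerator by [t + s] reduces its sign to [s * (t + s) <= 2 * t ^ 2], which
     follows from [s < t]. *)
  have e : (t - s) * (t + s) = 1 by rewrite -subr_sqr st; ring.
  move=> ts; rewrite -(pmulr_lge0 _ ts).
  rewrite [leRHS](_ : _ = 2 * t ^+ 2 * ((t - s) * (t + s)) - s * (t + s)); last by ring.
  by rewrite e mulr1 expr2; nra.
exists 3 => _ [n _ <-]; apply: (@le_trans _ _ (series u n.+2)).
  by rewrite -subr_ge0 sub_series_geq// ?sumr_ge0//; lia.
by apply: le_trans (ub n) _; rewrite gerBl divr_ge0// sqrtr_ge0.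
Qed.

Lemma abs_moebius_le1 (R : realType) (n : nat) : `|(moebius n)%:~R : R| <= 1.
Proof.
rewrite /moebius; case: ifP => _; last by rewrite normr0.
by rewrite rmorphXn rmorphN1 normrX normrN1 expr1n.
Qed.

(** The totient bound is spent on [j] alone: [j <= i * j] gives [sqrt j <= 2 * totient (i * j)]. In
    [i], the factor [i ^ 2 >= i * sqrt i] is enough. *)
Lemma abs_Sterm_le (R : realType) (m n i j : nat) :
  `|Sterm m n i j : R| <=
    (i%:R * Num.sqrt i%:R)^-1 * (2 * (j%:R * Num.sqrt j%:R)^-1).
Proof.
rewrite /Sterm; case: ifPn => [/and4P[i0 _ j0 _]|_]; last first.
  by rewrite normr0 !mulr_ge0// invr_ge0 mulr_ge0// sqrtr_ge0.
have ij0 : (0 < i * j)%N by rewrite muln_gt0 i0.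
have i1 : (1 : R) <= i%:R by rewrite ler1n.
have si : Num.sqrt i%:R <= i%:R :> R.
  by rewrite -[leRHS]ger0_norm// -sqrtr_sqr ler_wsqrtr// expr2 ler_peMl.
have si0 : 0 < Num.sqrt i%:R :> R by rewrite sqrtr_gt0 ltr0n.
have sj0 : 0 < Num.sqrt j%:R :> R by rewrite sqrtr_gt0 ltr0n.
have sj : Num.sqrt j%:R <= 2 * (totient (i * j))%:R :> R.
  rewrite -[leRHS]ger0_norm ?mulr_ge0// -sqrtr_sqr ler_wsqrtr//.
  rewrite -natrM -natrX ler_nat; have := leq_totient_sqr ij0; rewrite expnMn.
  have : (j <= i * j)%N by rewrite leq_pmull.
  lia.
have t0 : 0 < (totient (i * j))%:R :> R by rewrite ltr0n totient_gt0.
have d0 : 0 <= (i ^ 2)%:R * j%:R * (totient (i * j))%:R :> R by rewrite !mulr_ge0.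
rewrite normrM normfV (ger0_norm d0).
apply: (@le_trans _ _ ((i ^ 2)%:R * j%:R * (totient (i * j))%:R)^-1).
  by rewrite ler_piMl ?abs_moebius_le1// invr_ge0 !mulr_ge0.
rewrite mulrCA -invfM -[2]invrK -invfM lef_pV2 ?posrE ?mulr_gt0
  ?invr_gt0 ?ltr0n ?expn_gt0 ?i0 ?j0 ?totient_gt0//.
rewrite ler_pdivrMl//.
rewrite natrX expr2.
rewrite (_ : 2 * _ = (i%:R * i%:R) * (j%:R * (2 * (totient (i * j))%:R))); last by ring.
by rewrite ler_pM ?mulr_ge0 ?(ltW si0) ?(ltW sj0)// ler_wpM2l.
Qed.

(** Every factor lies in [[0, 1]], so the partial products decrease and stay nonnegative. *)
Lemma is_cvg_Spartial (R : realType) : cvgn (@Spartial R).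
Proof.
have bnd (p : nat) : prime p ->
    0 <= (1 - p%:R / (p%:R ^+ 3 - 1) : R) <= 1.
  move=> pp; set q : R := p%:R.
  have q2 : 2 <= q by rewrite ler_nat prime_gt1.
  have q34 : 4 * q <= q ^+ 3 by rewrite exprSr ler_wpM2r ?expr2//; nra.
  rewrite subr_ge0 gerBl divr_ge0 ?andbT; [|lra..].
  by rewrite ler_pdivrMr; lra.
apply: nonincreasing_is_cvgn; last first.
  by exists 0 => _ [n _ <-]; apply: prodr_ge0 => p /bnd/andP[].
apply/nonincreasing_seqP => n.
rewrite /Spartial big_mkcond [leRHS]big_mkcond/= big_ord_recr/= ler_piMr//.
  by apply: prodr_ge0 => p _; case: ifP => // /bnd/andP[].
by case: ifP => // /bnd/andP[].
Qed.

(** Once [N] exceeds every prime divisor of [m * n], only [Spartial N] still varies with [N], so the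
    limit of the product can be read off. *)
Lemma prod_local_factor (R : realType) (m n N : nat) :
    (0 < m)%N -> (0 < n)%N ->
    (forall p, prime p -> (p %| m * n)%N -> (p < N)%N) ->
  \prod_(p < N | prime p) local_factor R m n p =
  Spartial N / (m%:R ^+ 3 * n%:R ^+ 3)
  * (\prod_(p <- primes n) (- (p%:R ^+ 4) / (p%:R ^+ 3 - p%:R - 1)))
  * (\prod_(p <- primes m | ~~ (p %| n)%N)
        ((p%:R ^+ 3 + p%:R ^+ 2) / (p%:R ^+ 3 - p%:R - 1))).
Proof.
move=> m0 n0 mnN.
rewrite (@big_primes_ord _ _ _ N)//; last by move=> p pp pn; rewrite mnN// dvdn_mull.
rewrite (@big_primes_ord _ _ _ N m)//; last by move=> p pp pn; rewrite mnN// dvdn_mulr.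
rewrite /local_factor [LHS]big_split [X in _ * X = _]big_split/=.
rewrite [X in _ * (_ * X) = _]big_split/=.
rewrite [in RHS]big_mkcondr [in RHS]big_mkcondr.
have mn0 : (0 < m * n)%N by rewrite muln_gt0 m0.
have -> : (m%:R ^+ 3 * n%:R ^+ 3)^-1 =
    \prod_(p < N | prime p) (p%:R ^+ 3)^-1 ^+ (logn p m + logn p n) :> R.
  rewrite -exprMn -natrM -[in LHS](ppow_logn mn0 mnN) natr_prod -prodrXl -prodfV.
  by apply: eq_bigr => p _; rewrite lognM// exprVn natrX exprAC.
rewrite /Spartial mulrA [X in X * _ = _]mulrC -!mulrA; congr (_ * (_ * (_ * _))).
by apply: eq_bigr => p _; rewrite andbT.
Qed.

(** * Identification of the iterated sum with the closed form *)

Theorem theorem4p2 (R : realType) (m n : nat) (hm : (0 < m)%N) (hn : (0 < n)%N) :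
  cvgn (@Spartial R) /\
  exists T : nat -> R,
    (forall i : nat, series (fun j => @Sterm R m n i j) @ \oo --> T i) /\
    series T @ \oo --> @Sclosed R m n.
Proof.
split; first exact: is_cvg_Spartial.
pose g (k : nat) : R := (k%:R * Num.sqrt k%:R)^-1.
have g0 k : 0 <= g k by rewrite invr_ge0 mulr_ge0// sqrtr_ge0.
have cg : cvgn (series g) := @cvg_series_inv_mul_sqrt R.
have h0 k : 0 <= 2 * g k by rewrite mulr_ge0.
have ch : cvgn (series (fun k => 2 * g k)).
  by have := @is_cvg_seriesZ _ g 2 cg.
have [T [S [cT cS approx]]] :=
  dominated_double_series g0 h0 (@abs_Sterm_le R m n) cg ch.
exists T; split => //; suff <- : S = Sclosed m n by [].
pose L N : R := \prod_(p < N | prime p) local_factor R m n p.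
have mn0 : (0 < m * n)%N by rewrite muln_gt0 hm.
have mnN N : (m * n < N)%N -> forall p, prime p -> (p %| m * n)%N -> (p < N)%N.
  by move=> mnN p _ /(dvdn_leq mn0) pmn; exact: leq_ltn_trans mnN.
(* For fixed large [N], the bound [e] holds for every large [K], hence for the limit [L N] of
   [LK K]. *)
have cLS : L @ \oo --> S.
  apply/cvgrPdist_le => e e0; have [M HM] := approx e e0.
  near=> N.
  have MN : (M <= N)%N by near: N; exact: nbhs_infty_ge.
  have mN : (m * n < N)%N by near: N; exact: nbhs_infty_gt.
  pose LK K : R := \prod_(p < N | prime p)
    series (fun a => \sum_(b < 2) local_term R m n p a b) K.
  have cLK : `|S - LK K| @[K --> \oo] --> `|S - L N|.
    apply: cvg_norm; apply: cvgB; first exact: cvg_cst.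
    apply: cvg_big => [|p pp]; first exact: mul_continuous.
    exact: cvg_local_sum.
  rewrite -(cvg_lim _ cLK)//; apply: limr_le; first exact: cvgP cLK.
  near=> K.
  have MK : (M < K)%N by near: K; exact: nbhs_infty_gt.
  (* The partial sum [series _ K] runs over [a < K], so the largest exponent is [K.-1]; it exceeds
     no less than all exponents in [i < M] because [M < K]. *)
  have [s [us sP sum_s]] := euler_product_finite R K.-1 hm hn (mnN N mN).
  have -> : LK K = \sum_(x <- s) Sterm m n x.1 x.2.
    rewrite sum_s (ltn_predK MK); apply: eq_bigr => p _.
    by rewrite /series/= big_mkord.
  (* A nonzero term forces [j] to be squarefree, and the prime factors of [i] and [j] are below
     [M <= N]. *)
  apply: HM => // i j iM jM; rewrite /Sterm.
  case: ifPn => [/and4P[i0 _ j0 _] ne0|]; last by rewrite eqxx.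
  apply: sP => // [|p pp|p].
  - by apply: contraNT ne0 => nsj; rewrite /moebius (negbTE nsj) mul0r.
  - by rewrite Euclid_dvdM// => /orP[] /dvdn_leq; lia.
  - by have := ltn_logn p i0 iM; lia.
have cLC : L @ \oo --> Sclosed m n.
  rewrite /Sclosed; set A := \prod_(p <- primes n) _.
  set B := \prod_(p <- primes m | _) _.
  have : Spartial N / (m%:R ^+ 3 * n%:R ^+ 3) * A * B @[N --> \oo] -->
      @Sconst R / (m%:R ^+ 3 * n%:R ^+ 3) * A * B.
    by do 3 apply: cvgM (cvg_cst _) => //; exact: is_cvg_Spartial.
  apply: cvg_trans; apply: near_eq_cvg; near=> N.
  have mN : (m * n < N)%N by near: N; exact: nbhs_infty_gt.
  by rewrite /L prod_local_factor//; exact: mnN.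
exact: cvg_unique cLS cLC.
Unshelve. all: by end_near. Qed.
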